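(* Let $\chi$ and $\tilde\chi$ be two partition functions, and let $d_{\mathcal{D}}$ and $\tilde d_{\mathcal{D}}$ be the metrics on $\mathcal{D}$ induced by $\chi$ and $\tilde\chi$, respectively. Then these metrics are equivalent, that is, there exists a constant $C>0$ which only depends on $\chi$ and $\tilde\chi$ such that $$\frac1C\,\tilde d_{\mathcal{D}}((\bar u,\bar\mu),(u,\mu))\le d_{\mathcal{D}}((\bar u,\bar\mu),(u,\mu))\le C\,\tilde d_{\mathcal{D}}((\bar u,\bar\mu),(u,\mu))$$ for any $(\bar u,\bar\mu)$ and $(u,\mu)$ in $\mathcal{D}$.
   Context: A partition function is a $\chi\in C^\infty(\mathbb{R})$ with $\chi(x)=0$ for $x\le 0$, $\chi(x)=1$ for $x\ge1$, and $\chi'\ge0$. $H_{0,\infty}(\mathbb{R})$ is the space of functions $U=\bar U+c\chi$ with $\bar U\in H^1(\mathbb{R})$, $c\in\mathbb{R}$; as a vector space it does not depend on $\chi$, and the pair $(\bar U,c)=:I_\chi^{-1}(U)$ is uniquely determined by $U$ and $\chi$. Let $V=\{f\in C(\mathbb{R})\cap L^\infty(\mathbb{R}) : f_\xi\in L^2(\mathbb{R})\}$ with norm $\|f\|_V=\|f\|_{L^\infty}+\|f_\xi\|_{L^2}$. Let $E=V\times H_{0,\infty}(\mathbb{R})\times L^2(\mathbb{R})$; a partition function $\chi$ gives the norm $$\|(\zeta,U,h)\|_{E_\chi}=\|\zeta\|_V+\|\bar U\|_{H^1}+|c|+\|h\|_{L^2},\qquad (\bar U,c)=I_\chi^{-1}(U).$$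 $\mathcal{D}$ is the set of pairs $(u,\mu)$ with $u\in H_{0,\infty}(\mathbb{R})$ and $\mu$ a positive finite Radon measure on $\mathbb{R}$ whose absolutely continuous part is $\mu_{ac}=u_x^2\,dx$. For $(u,\mu)\in\mathcal{D}$ let $y(\xi)=\sup\{y:\mu((-\infty,y))+y<\xi\}$, $U=u\circ y$, $h=1-y_\xi$, $\zeta(\xi)=y(\xi)-\xi$; then $(\zeta,U,h)\in E$, and one sets $L(u,\mu)=(\zeta,U,h)$. The metrics induced by $\chi$ and $\tilde\chi$ are $$d_{\mathcal{D}}((u,\mu),(\bar u,\bar\mu))=\|L(u,\mu)-L(\bar u,\bar\mu)\|_{E_\chi},\qquad \tilde d_{\mathcal{D}}((u,\mu),(\bar u,\bar\mu))=\|L(u,\mu)-L(\bar u,\bar\mu)\|_{E_{\tilde\chi}}.$$ *)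

(* Defs.v *)
From mathcomp Require Import all_boot all_order all_algebra.
From mathcomp Require Import all_classical all_reals all_analysis.

Set Implicit Arguments.
Unset Strict Implicit.
Unset Printing Implicit Defensive.

Import Order.TTheory GRing.Theory Num.Theory.
Import numFieldNormedType.Exports.

Local Open Scope classical_set_scope.
Local Open Scope ring_scope.

Section Spaces.
Context {R : realType}.

Local Notation leb := (@lebesgue_measure R).

Definition smooth (f : R -> R) : Prop :=
  forall (n : nat) (x : R), derivable (derive1n n f) x 1.

Definition partition_function (chi : R -> R) : Prop :=
  [/\ smooth chi,
      forall x, x <= 0 -> chi x = 0,
      forall x, 1 <= x -> chi x = 1
    & forall x, 0 <= derive1 chi x].

Definition test_function (phi : R -> R) : Prop :=
  smooth phi /\ compact (closure [set x | phi x != 0]).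

Definition weak_derivative (f g : R -> R) : Prop :=
  [/\ locally_integrable setT f, locally_integrable setT g
    & forall phi, test_function phi ->
      \int[leb]_x (f x * derive1 phi x) = - \int[leb]_x (g x * phi x)].

(* A representative of the weak derivative, which is unique up to a.e.
   equality; 0 if there is none. *)
Definition wderiv (f : R -> R) : R -> R :=
  xget (cst 0) [set g | weak_derivative f g].

Definition L2 : set (R -> R) := [set f | f \in Lfun leb 2%:E].

Definition normL2 (f : R -> R) : \bar R := 'N[leb]_2%:E[EFin \o f]%E.

Definition Linfty : set (R -> R) := [set f | f \in Lfun leb +oo%E].

Definition normLinfty (f : R -> R) : \bar R := 'N[leb]_+oo[EFin \o f]%E.

(* Elements of H^1(R) are taken to be the continuous representatives, so that
   pointwise values and the composition u \o y below make sense. *)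
Definition H1 : set (R -> R) :=
  [set f | [/\ continuous f, L2 f & exists2 g, weak_derivative f g & L2 g]].

Definition normH1 (f : R -> R) : \bar R :=
  ((normL2 f ^+ 2 + normL2 (wderiv f) ^+ 2) `^ 2^-1)%E.

Definition Imap (chi : R -> R) (p : (R -> R) * R) : R -> R :=
  fun x => p.1 x + p.2 * chi x.

Definition Iinv (chi U : R -> R) : (R -> R) * R :=
  xget (cst 0, 0) [set p | H1 p.1 /\ Imap chi p = U].

(* The space does not depend on the choice of the partition function. *)
Definition H0oo : set (R -> R) :=
  [set U | exists chi, partition_function chi /\
           exists p, H1 p.1 /\ Imap chi p = U].

Definition Vspace : set (R -> R) :=
  [set f | [/\ continuous f, Linfty f
             & exists2 g, weak_derivative f g & L2 g]].

Definition normV (f : R -> R) : \bar R :=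
  (normLinfty f + normL2 (wderiv f))%E.

Definition Espace : set ((R -> R) * (R -> R) * (R -> R)) :=
  [set X | [/\ Vspace X.1.1, H0oo X.1.2 & L2 X.2]].

(* The usual norm on Espace, extended by +oo outside of it; since Lmap sends
   Dspace into Espace, distD below only takes finite values on Dspace. *)
Definition normE (chi : R -> R) (X : (R -> R) * (R -> R) * (R -> R)) : \bar R :=
  let: (zeta, U, h) := X in
  let: (Ubar, c) := Iinv chi U in
  if `[< Espace X >] then (normV zeta + normH1 Ubar + `|c|%:E + normL2 h)%E
  else +oo%E.

Local Notation RB := (measurableTypeR R).

Definition radon (mu : {measure set RB -> \bar R}) : Prop :=
  (forall K : set R, compact K -> mu K < +oo)%E /\
  (forall A : set RB, measurable A ->
     mu A = ereal_sup [set mu K | K in [set K : set R | compact K /\ K `<=` A]]).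

Definition mutually_singular (mu nu : {measure set RB -> \bar R}) : Prop :=
  exists A : set RB, [/\ measurable A, mu A = 0%E & nu (~` A) = 0%E].

Definition ac_part (mu : {measure set RB -> \bar R}) (nu : set RB -> \bar R) :
    Prop :=
  nu `<< leb /\
  exists mus : {measure set RB -> \bar R}, mutually_singular mus leb /\
    forall A : set RB, measurable A -> mu A = (nu A + mus A)%E.

Definition Dspace : set ((R -> R) * {finite_measure set RB -> \bar R}) :=
  [set p : (R -> R) * {finite_measure set RB -> \bar R} |
           [/\ H0oo p.1, radon p.2
             & ac_part p.2
                 (fun A => \int[leb]_(x in A) ((wderiv p.1 x) ^+ 2)%:E)%E]].

Definition ymap (mu : {finite_measure set RB -> \bar R}) (xi : R) : R :=
  sup [set y : R | (mu `]-oo, y[%classic + y%:E < xi%:E)%E].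

Definition Lmap (p : (R -> R) * {finite_measure set RB -> \bar R}) :
    (R -> R) * (R -> R) * (R -> R) :=
  let y := ymap p.2 in
  (fun xi => y xi - xi, p.1 \o y, fun xi => 1 - derive1 y xi).

Definition distD (chi : R -> R)
    (p q : (R -> R) * {finite_measure set RB -> \bar R}) : \bar R :=
  normE chi (Lmap p - Lmap q).

End Spaces.

(* Main.v *)
(* Writing U = f + c chi = f' + c' chi', the function f - f' lies in L^2 and equals
   c' - c on [1, +oo[, so c = c' and f = f' + c (chi' - chi). As chi' - chi is smooth
   with compact support, it has a finite H^1 norm K, and the two norms of U differ by
   at most a factor depending on K only; the other components do not involve chi.

   The H^1 norm is computed on an arbitrary representative of the weak derivative, so
   its triangle inequality rests on the a.e. uniqueness of weak derivatives. This is
   proved at Lebesgue points, with test functions built by rescaling chi itself. *)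
Require Import Defs.
From mathcomp Require Import all_boot all_order all_algebra.
From mathcomp Require Import all_classical all_reals all_analysis.
From mathcomp Require Import measurable_realfun.
From mathcomp Require Import ring lra.

Set Implicit Arguments.
Unset Strict Implicit.
Unset Printing Implicit Defensive.

Import Order.TTheory GRing.Theory Num.Theory.
Import numFieldNormedType.Exports.

Local Open Scope classical_set_scope.
Local Open Scope ring_scope.

(** * Smooth functions: affine rescaling, differences, supports of test functions *)

Section Smooth.
Context {R : realType}.
Implicit Types (f g phi : R -> R) (a b x : R).

Lemma smooth_derivable f x : smooth f -> derivable f x 1.
Proof. by move=> /(_ 0%N x). Qed.

Lemma derivable_continuousT f : (forall x, derivable f x 1) -> continuous f.
Proof. by move=> df x; exact/differentiable_continuous/derivable1_diffP. Qed.

Lemma smooth_derive1 f : smooth f -> smooth (derive1 f).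
Proof. by move=> sf n x; rewrite /derive1n -iterSr; exact: (sf n.+1). Qed.

Lemma smooth_continuous f : smooth f -> continuous f.
Proof. by move=> sf; apply: derivable_continuousT => x; exact: smooth_derivable. Qed.

Lemma is_derive_affine f a b x : derivable f (a * x + b) 1 ->
  is_derive x 1 (fun y => f (a * y + b)) (a * derive1 f (a * x + b)).
Proof.
move=> df.
have da : is_derive x 1 (fun y => a * y + b) a.
  by apply: is_derive_eq; rewrite addr0 [LHS]mulr1.
have df' : is_derive (a * x + b) 1 f (derive1 f (a * x + b)).
  by rewrite derive1E; exact/derivableP.
by have := @is_derive1_comp _ f (fun y => a * y + b) x _ _ df' da; rewrite mulrC.
Qed.

(** The iterated chain rule in closed form: each derivative of the rescaled function is again a
    multiple of a rescaled smooth function, so it can be differentiated once more. *)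
Lemma derive1n_affine f a b n : smooth f ->
  derive1n n (fun y => f (a * y + b)) =
  (fun y => a ^+ n * derive1n n f (a * y + b)).
Proof.
move=> sf; elim: n => [|n ih]; first by apply/funext => y; rewrite expr0 mul1r.
rewrite derive1nS ih; apply/funext => y.
have d := is_derive_affine (sf n (a * y + b)).
rewrite derive1E deriveZ/=; last exact: ex_derive.
by rewrite derive_val exprSr -mulrA.
Qed.

Lemma smooth_affine f a b : smooth f -> smooth (fun y => f (a * y + b)).
Proof.
move=> sf n x; rewrite derive1n_affine//.
have d := is_derive_affine (sf n (a * x + b)).
by apply: derivableZ; exact: ex_derive.
Qed.

Lemma smoothB f g : smooth f -> smooth g -> smooth (fun x => f x - g x).
Proof.
move=> sf sg n x.
suff -> : derive1n n (fun x => f x - g x) = derive1n n f - derive1n n g.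
  exact: derivableB.
elim: n => [//|n ih]; rewrite derive1nS ih; apply/funext => y.
by rewrite derive1E deriveB// -!derive1E.
Qed.

Lemma derive1_eq0_near f x : (\forall y \near x, f y = 0) -> derive1 f x = 0.
Proof. by move=> f0; rewrite derive1E (near_eq_derive (g := cst 0))// derive_cst. Qed.

Lemma test_function_supp phi : test_function phi ->
  exists2 M, 0 < M & forall x, M <= `|x| -> phi x = 0 /\ derive1 phi x = 0.
Proof.
move=> [sphi /compact_bounded[N [Nreal bN]]].
(* [N] bounds the support only through reals strictly above it, hence [|N| + 1]. The second unit
   makes [phi] vanish on a whole neighbourhood of [x], which also kills the derivative there. *)
exists (`|N| + 2); first by rewrite ltr_wpDl.
have phi0 x : `|N| + 1 < `|x| -> phi x = 0.
  move=> Nx; apply/eqP; apply: contraTT Nx => phix; rewrite -leNgt.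
  apply: bN; last exact: subset_closure.
  by rewrite (le_lt_trans (ler_norm _))// ltrDl.
move=> x Mx; have N1x : `|N| + 1 < `|x|.
  by rewrite (lt_le_trans _ Mx)// ltrD2l ltr1n.
split; first exact: phi0.
apply: derive1_eq0_near; near=> y; apply: phi0; near: y.
by apply: (cvgr_norm_gt x) => //; exact: cvg_id.
Unshelve. all: by end_near. Qed.

End Smooth.

(** * Weak derivatives *)

Section WeakDerivative.
Context {R : realType}.
Implicit Types (f g phi : R -> R) (M x : R).
Local Notation leb := (@lebesgue_measure R).

Lemma continuous_locally_integrable f : continuous f -> locally_integrable setT f.
Proof.
move=> cf; split => //; first exact: continuous_measurable_fun.
  exact: openT.
move=> K _ cK.
have /integrableP[] := continuous_compact_integrable cK (continuous_subspaceT cf).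
by [].
Qed.

(** On the compact interval [[- M, M]] the product is an integrable function times a bounded one;
    outside it is zero. *)
Lemma integrable_mul_supp f phi M : locally_integrable setT f ->
  continuous phi -> (forall x, M <= `|x| -> phi x = 0) ->
  leb.-integrable setT (fun x => (f x * phi x)%:E).
Proof.
move=> [mf _ intf] cphi phi0.
have mK : measurable (`[- M, M]%classic : set (measurableTypeR R)) by [].
have fK : leb.-integrable `[- M, M]%classic (EFin \o f).
  apply/integrableP; split; last by apply: intf => //; exact: segment_compact.
  by apply/measurable_EFinP; exact: measurable_funTS.
have [N [_ bN]] : bounded_set (phi @` `[- M, M]).
  by apply/compact_bounded/continuous_compact;
    [exact: continuous_subspaceT|exact: segment_compact].
have bphi : [bounded phi x | x in (`[- M, M]%classic : set R)].
  by exists N; split; rewrite ?num_real// => y Ny x Kx; apply: bN => //; exists x.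
have mphi : measurable_fun (`[- M, M]%classic : set (measurableTypeR R)) phi.
  by apply: measurable_funTS; exact: continuous_measurable_fun.
have /(integrable_mkcond _ mK) := integrableMl mK fK mphi bphi.
apply: eq_integrable => // x _; rewrite patchE; case: ifPn => // xK.
rewrite /= phi0 ?mulr0//; move: xK; rewrite notin_setE/= in_itv/= => /negP.
by rewrite -ler_norml -ltNge => /ltW.
Qed.

Lemma integrable_mul_test f phi : locally_integrable setT f ->
  test_function phi -> leb.-integrable setT (fun x => (f x * phi x)%:E).
Proof.
move=> lf tphi; have [M _ phi0] := test_function_supp tphi.
apply: (@integrable_mul_supp _ _ M lf (smooth_continuous tphi.1)) => x.
by move=> /phi0[].
Qed.

Lemma integrable_mul_derive1_test f phi : locally_integrable setT f ->
  test_function phi -> leb.-integrable setT (fun x => (f x * derive1 phi x)%:E).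
Proof.
move=> lf tphi; have [M _ phi0] := test_function_supp tphi.
apply: (@integrable_mul_supp _ _ M lf).
  exact/smooth_continuous/smooth_derive1/tphi.1.
by move=> x /phi0[].
Qed.

Lemma Rintegral_supp f M : (forall x, M <= `|x| -> f x = 0) ->
  \int[leb]_x f x = \int[leb]_(x in `[- M, M]) f x.
Proof.
move=> f0; rewrite [RHS]Rintegral_mkcond; apply: eq_Rintegral => x _.
rewrite patchE; case: ifPn => //; rewrite notin_setE/= in_itv/= => /negP.
by rewrite -ler_norml -ltNge => /ltW/f0.
Qed.

(** Integration by parts on [[- M, M]], where [M] is so large that the boundary terms vanish with
    [phi]. *)
Lemma weak_derivative_C1 f : (forall x, derivable f x 1) ->
  continuous (derive1 f) -> weak_derivative f (derive1 f).
Proof.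
move=> df cdf; have cf := derivable_continuousT df.
split; [exact: continuous_locally_integrable..|].
move=> phi tphi; have [M M0 phi0] := test_function_supp tphi.
have sphi := tphi.1.
have LR (h : R -> R) : (forall x, derivable h x 1) ->
    derivable_oo_LRcontinuous h (- M) M.
  move=> dh; have ch := derivable_continuousT dh.
  split; first by move=> x _; exact: dh.
  - exact/cvg_at_right_filter/ch.
  - exact/cvg_at_left_filter/ch.
rewrite (@Rintegral_supp (fun x => f x * derive1 phi x) M); last first.
  by move=> x /phi0[_ ->]; rewrite mulr0.
rewrite (@Rintegral_supp (fun x => derive1 f x * phi x) M); last first.
  by move=> x /phi0[-> _]; rewrite mulr0.
rewrite (@Rintegration_by_parts _ f phi (derive1 f) (derive1 phi))//.
- rewrite (phi0 M _).1 ?(phi0 (- M) _).1 ?normrN ?ler_norm//.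
  by rewrite !mulr0 subrr sub0r.
- by rewrite -subr_gt0 opprK addr_gt0.
- exact: continuous_subspaceT.
- exact: LR.
- exact/continuous_subspaceT/smooth_continuous/smooth_derive1.
- by apply: LR => x; exact: smooth_derivable.
Qed.

Lemma weak_derivativeD f f' g g' : weak_derivative f f' -> weak_derivative g g' ->
  weak_derivative (f \+ g) (f' \+ g').
Proof.
move=> [lf lf' wf] [lg lg' wg]; split; [exact: locally_integrableD..|].
move=> phi tphi.
under eq_Rintegral do rewrite /= mulrDl.
under [in RHS]eq_Rintegral do rewrite /= mulrDl.
rewrite !RintegralD ?wf ?wg ?opprD//.
all: by [exact: integrable_mul_test|exact: integrable_mul_derive1_test].
Qed.

Lemma locally_integrableZ (c : R) f : locally_integrable setT f ->
  locally_integrable setT (fun x => c * f x).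
Proof.
move=> [mf oT intf]; split => //; first exact: measurable_funM.
move=> K _ cK; have mK : measurable (K : set (measurableTypeR R)).
  exact: compact_measurable.
have fK : leb.-integrable K (EFin \o f).
  apply/integrableP; split; last exact: intf.
  by apply/measurable_EFinP; exact: measurable_funTS.
by have /integrableP[] := integrableZl mK c fK.
Qed.

Lemma weak_derivativeZ (c : R) f f' : weak_derivative f f' ->
  weak_derivative (fun x => c * f x) (fun x => c * f' x).
Proof.
move=> [lf lf' wf]; split; [exact: locally_integrableZ..|].
move=> phi tphi.
under eq_Rintegral do rewrite /= -mulrA.
under [in RHS]eq_Rintegral do rewrite /= -mulrA.
rewrite !RintegralZl ?wf ?mulrN//.
all: by [exact: integrable_mul_test|exact: integrable_mul_derive1_test].
Qed.

End WeakDerivative.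

(** * Uniqueness of weak derivatives *)

Section FundamentalLemma.
Context {R : realType}.
Implicit Types (chi f g phi : R -> R) (c x s : R).
Local Notation leb := (@lebesgue_measure R).

Lemma partition_function_homo chi : partition_function chi ->
  {homo chi : x y / x <= y}.
Proof.
move=> [schi _ _ dchi] x y xy.
apply: (@ger0_derive1_ndecr _ chi x y) => //.
- by move=> z _; exact: smooth_derivable.
- exact/continuous_subspaceT/smooth_continuous.
Qed.

(** The bump is the difference of two rescaled copies of [chi], one climbing from 0 to 1 on
    [[x, x + s]], the other on [[x + 2 * s, x + 3 * s]]. *)
Lemma test_function_bump chi x s : partition_function chi -> 0 < s ->
  exists phi, [/\ test_function phi, forall y, 0 <= phi y <= 1,
    forall y, ~ (x < y < x + 3 * s) -> phi y = 0
  & forall y, x + s <= y <= x + 2 * s -> phi y = 1].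
Proof.
move=> pchi s0; have [schi chi0 chi1 _] := pchi.
have hchi := partition_function_homo pchi.
pose a := s^-1; have a0 : 0 < a by rewrite invr_gt0.
have as1 : a * s = 1 by rewrite mulVf// gt_eqF.
have out y : ~ (x < y < x + 3 * s) ->
    chi (a * y - a * x) - chi (a * y - (a * x + 2)) = 0.
  move=> xys; have [yx|xy] := leP y x.
    by rewrite !chi0 ?subrr//; nra.
  have {xys} ys : x + 3 * s <= y.
    by rewrite leNgt; apply/negP => ys; apply: xys; rewrite xy.
  by rewrite !chi1 ?subrr//; nra.
exists (fun y => chi (a * y - a * x) - chi (a * y - (a * x + 2))).
split => //.
- split; first by apply: smoothB; exact: smooth_affine.
  apply: (@subclosed_compact _ _ `[x, x + 3 * s]%classic).
  + exact: closed_closure.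
  + exact: segment_compact.
  + rewrite closureE; apply: smallest_sub; first exact: itv_closed.
    move=> y /= /eqP nz; rewrite in_itv/=.
    have [/andP[/ltW -> /ltW ->]//|/negP/out//] := boolP (x < y < x + 3 * s).
(* Nonnegativity is the monotonicity of [chi]; the upper bound holds because both copies take values
   in [[0, 1]]. *)
- move=> y; rewrite subr_ge0 hchi/=; last by lra.
  have h z : 0 <= chi z <= 1.
    apply/andP; split.
      by have [/chi0->//|/ltW/hchi] := leP z 0; rewrite (chi0 0).
    by have [/chi1->//|/ltW/hchi] := leP 1 z; rewrite (chi1 1).
  by have /andP[_] := h (a * y - a * x); have /andP[] := h (a * y - (a * x + 2)); lra.
- move=> y /andP[y1 y2]; rewrite chi1 ?chi0 ?subr0//; nra.
Qed.

(* Test [g] against a bump that lives in [ball x r] and equals [1] on an interval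
   of length [r / 3]: [0 = int g phi = g x * int phi + int (g - g x) phi]. *)
Lemma davg_ge_orthogonal chi g x r : partition_function chi ->
  locally_integrable setT g ->
  (forall phi, test_function phi -> \int[leb]_y (g y * phi y) = 0) ->
  0 < r -> ((`|g x| / 6)%:E <= davg g x r)%E.
Proof.
move=> pchi lg g0 r0; set c := g x.
have s0 : 0 < r / 3 by lra.
have [phi [tphi phi01 phi0 phi1]] := test_function_bump x pchi s0.
set s := r / 3 in s0 phi0 phi1.
have lcst d : locally_integrable setT (cst d : R -> R).
  by apply: continuous_locally_integrable => z; exact: cvg_cst.
have igphi := integrable_mul_test lg tphi.
have iphi : leb.-integrable setT (EFin \o phi).
  have := integrable_mul_test (lcst 1) tphi.
  by apply: eq_integrable => // y _ /=; rewrite mul1r.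
have icphi := integrable_mul_test (lcst c) tphi.
have lgc : locally_integrable setT (fun y => g y - c).
  exact: (locally_integrableB lg (lcst c)).
have ihphi := integrable_mul_test lgc tphi.
have sphi : (s%:E <= \int[leb]_y (phi y)%:E)%E.
  apply: (@le_trans _ _
    (\int[leb]_(y in `[(x + s)%R, (x + 2 * s)%R]) (phi y)%:E)%E); last first.
    apply: ge0_subset_integral => //.
      apply/measurable_EFinP; apply: continuous_measurable_fun.
      exact: smooth_continuous tphi.1.
    by move=> y _; rewrite lee_fin; have /andP[] := phi01 y.
  rewrite (eq_integral (cst 1%E)); last first.
    by move=> y; rewrite inE/= in_itv/= => /phi1 ->.
  rewrite integral_cst//= lebesgue_measure_itv/= lte_fin ifT; last by lra.
  by rewrite mul1e -EFinD lee_fin; lra.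
have eqint : \int[leb]_y ((g y - c) * phi y) = - (c * \int[leb]_y phi y).
  under eq_Rintegral do rewrite mulrBl.
  by rewrite RintegralB// g0// sub0r RintegralZl.
have key : ((`|c| * s)%:E <= \int[leb]_(y in ball x r) `|(g y - c)%:E|)%E.
  apply: (@le_trans _ _ `|\int[leb]_y ((g y - c) * phi y)%:E|%E).
    rewrite -EFin_normr_Rintegral// eqint normrN normrM lee_fin ler_wpM2l//.
    rewrite (le_trans _ (ler_norm _))// -lee_fin /Rintegral fineK//.
    exact: integrable_fin_num.
  apply: (le_trans (le_abse_integral _ _ _)) => //.
    by case/integrableP : ihphi.
  rewrite [leRHS]integral_mkcond; apply: ge0_le_integral => //.
  - by apply: measurableT_comp => //; case/integrableP : ihphi.
  - apply/(measurable_restrictT _ _).1 => //; first exact: measurable_ball.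
    apply: measurableT_comp => //; apply/measurable_EFinP/measurable_funTS.
    by case: lgc.
  - move=> y _; rewrite patchE; case: ifPn => [_|].
      rewrite /= lee_fin normrM ler_piMr//.
      by have /andP[? ?] := phi01 y; rewrite ger0_norm.
    rewrite notin_setE ball_itv/= in_itv/= => xyr.
    rewrite phi0 ?mulr0 ?normr0//= => /andP[xy yx]; apply: xyr.
    by apply/andP; split; rewrite /s in yx; lra.
(* The ball has measure [2 * r] and [s = r / 3], whence the factor [1 / 6]. *)
rewrite /davg /iavg (lebesgue_measure_ball _ (ltW r0)).
have r20 : 0 < r *+ 2 by rewrite mulrn_wgt0.
rewrite inver gt_eqF// -lee_pdivrMl ?invr_gt0// invrK.
apply: le_trans key; rewrite -EFinM lee_fin /s.
by rewrite -mulr_natl; lra.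
Qed.

(** At a Lebesgue point the mean deviation [davg g x r] tends to 0 with [r], yet it stays above
    [|g x| / 6]. *)
Lemma fundamental_lemma_ae chi g : partition_function chi ->
  locally_integrable setT g ->
  (forall phi, test_function phi -> \int[leb]_y (g y * phi y) = 0) ->
  {ae leb, forall x, g x = 0}.
Proof.
move=> pchi lg g0; have := lebesgue_differentiation lg.
apply: filterS; first exact: (ae_filter_ringOfSetsType leb).
move=> x lx; apply/eqP; rewrite -normr_le0.
suff : ((`|g x| / 6)%:E <= 0)%E by rewrite lee_fin; lra.
apply: (cvge_to_ge lx); near=> r.
exact: (davg_ge_orthogonal x pchi lg g0).
Unshelve. all: by end_near. Qed.

Lemma weak_derivative_unique chi f g h : partition_function chi ->
  weak_derivative f g -> weak_derivative f h -> ae_eq leb setT g h.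
Proof.
move=> pchi [_ lg wg] [_ lh wh].
have : {ae leb, forall x, (g \- h)%R x = 0}.
  apply: (fundamental_lemma_ae pchi); first exact: locally_integrableB.
  move=> phi tphi; under eq_Rintegral do rewrite /= mulrBl.
  rewrite RintegralB//; [|exact: integrable_mul_test..].
  by apply/eqP; rewrite subr_eq0 -eqr_opp -wg// -wh.
apply: filterS; first exact: (ae_filter_ringOfSetsType leb).
by move=> x /eqP; rewrite subr_eq0 => /eqP.
Qed.

End FundamentalLemma.

(** * Change of partition function *)

Section Sobolev.
Context {R : realType}.
Implicit Types (chi f g phi : R -> R) (c x s : R).
Local Notation leb := (@lebesgue_measure R).

(** * The [L^2] norm, and its value on weak derivatives *)

Lemma L2P f : L2 f <-> measurable_fun setT f /\ (normL2 f < +oo)%E.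
Proof.
rewrite /L2/= /Lfun; split.
  by move=> /andP[]; rewrite !inE.
by move=> [mf nf]; apply/andP; rewrite !inE.
Qed.

Lemma normL2_ge0 f : (0 <= normL2 f)%E. Proof. exact: Lnorm_ge0. Qed.

Lemma normL2D f g : measurable_fun setT f -> measurable_fun setT g ->
  (normL2 (f \+ g)%R <= normL2 f + normL2 g)%E.
Proof. by move=> mf mg; apply: minkowski_EFin => //; rewrite ler1n. Qed.

Lemma normL2Z c f : L2 f -> normL2 (fun x => c * f x) = (`|c|%:E * normL2 f)%E.
Proof.
move=> hf; have p1 : ((1 : R)%:E <= 2%:E)%E by rewrite lee_fin ler1n.
exact: (LnormZ (Lfun_Sub p1 hf) c).
Qed.

Lemma L2D f g : L2 f -> L2 g -> L2 (f \+ g).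
Proof.
move=> /L2P[mf nf] /L2P[mg ng]; apply/L2P; split; first exact: measurable_funD.
by rewrite (le_lt_trans (normL2D mf mg))// lte_add_pinfty.
Qed.

Lemma L2Z c f : L2 f -> L2 (fun x => c * f x).
Proof.
move=> hf; have /L2P[mf nf] := hf; apply/L2P; split; first exact: measurable_funM.
by rewrite normL2Z// lte_mul_pinfty.
Qed.

Lemma ae_eq_normL2 f g : measurable_fun setT f -> measurable_fun setT g ->
  ae_eq leb setT f g -> normL2 f = normL2 g.
Proof.
move=> mf mg fg; rewrite /normL2 unlock; congr poweR.
have mp (h : R -> R) : measurable_fun setT h ->
    measurable_fun setT (fun x : measurableTypeR R => (`|(h x)%:E| `^ 2)%E).
  move=> mh; apply: (measurableT_comp (measurable_poweR _)) => //.
  by apply: measurableT_comp => //; apply/measurable_EFinP.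
apply: ge0_ae_eq_integral => //=.
- exact: mp.
- exact: mp.
- apply: (@filterS _ _ (ae_filter_ringOfSetsType leb) _ _ _ fg).
  by move=> x /= fgx _; rewrite fgx.
Qed.

(** Here [integrable_mul_supp] is used with [f] in both roles, so that [f * f] is integrable. *)
Lemma L2_continuous_supp f (M : R) : continuous f ->
  (forall x, M <= `|x| -> f x = 0) -> L2 f.
Proof.
move=> cf f0; apply/L2P; split; first exact: continuous_measurable_fun.
have lf := continuous_locally_integrable cf.
have /integrableP[_] := integrable_mul_supp lf cf f0.
rewrite /normL2 unlock => intf; apply: poweR_lty.
apply: le_lt_trans intf; apply: ge0_le_integral => //.
- by move=> x _; exact: poweR_ge0.
- apply: (measurableT_comp (measurable_poweR _)) => //.
  apply: measurableT_comp => //; apply/measurable_EFinP.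
  exact: continuous_measurable_fun.
- apply/measurable_EFinP; apply: measurableT_comp => //.
  by apply: measurable_funM; exact: continuous_measurable_fun.
- by move=> x _; rewrite lee_fin powR_mulrn// normrM expr2.
Qed.

Lemma weak_derivative_wderiv f g : weak_derivative f g -> weak_derivative f (wderiv f).
Proof. by move=> fg; apply: (@xgetPex _ _ [set h | weak_derivative f h]); exists g. Qed.

(** Frees the norm from the choice made by [wderiv]: any explicit weak derivative may be used to
    compute it. *)
Lemma normL2_wderiv chi f g : partition_function chi -> weak_derivative f g ->
  normL2 (wderiv f) = normL2 g.
Proof.
move=> pchi fg; have fw := weak_derivative_wderiv fg.
have [_ [mg _ _] _] := fg; have [_ [mw _ _] _] := fw.
exact/ae_eq_normL2/(weak_derivative_unique pchi fw fg).
Qed.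

(** * The space [H^1] and its norm *)

Lemma H1D f g : H1 f -> H1 g -> H1 (f \+ g).
Proof.
move=> [cf hf [f' wf hf']] [cg hg [g' wg hg']]; split.
- by move=> x; apply: continuousD; [exact: cf|exact: cg].
- exact: L2D.
- by exists (f' \+ g'); [exact: weak_derivativeD|exact: L2D].
Qed.

Lemma H1Z c f : H1 f -> H1 (fun x => c * f x).
Proof.
move=> [cf hf [f' wf hf']]; split.
- by move=> x; apply: continuousM; [exact: cvg_cst|exact: cf].
- exact: L2Z.
- by exists (fun x => c * f' x); [exact: weak_derivativeZ|exact: L2Z].
Qed.

(** Partition functions agree on [x <= 0] and on [1 <= x], so their difference is a test function;
    it and its derivative are then continuous with bounded support. *)
Lemma H1_partition_functionB chi chi' :
  partition_function chi -> partition_function chi' ->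
  H1 (fun x => chi x - chi' x).
Proof.
move=> [s z o _] [s' z' o' _]; set d := fun x => _.
have sd : smooth d by exact: smoothB.
have d0 x : 1 <= `|x| -> d x = 0.
  rewrite ler_normr /d => /orP[x1|x1]; first by rewrite o ?o' ?subrr.
  by rewrite z ?z' ?subrr//; lra.
have td : test_function d.
  split => //; apply: (@subclosed_compact _ _ `[- (1 : R), 1]%classic).
  - exact: closed_closure.
  - exact: segment_compact.
  - rewrite closureE; apply: smallest_sub; first exact: itv_closed.
    move=> x /= /eqP nz; rewrite in_itv/= -ler_norml leNgt.
    by apply/negP => /ltW/d0.
have [M M0 dM] := test_function_supp td.
have cd := smooth_continuous sd.
have cd' := smooth_continuous (smooth_derive1 sd).
split => //.
- by apply: (L2_continuous_supp cd) => x /dM[].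
- exists (derive1 d); last by apply: (L2_continuous_supp cd') => x /dM[].
  by apply: weak_derivative_C1 => // x; exact: smooth_derivable.
Qed.

(** A norm equivalent to that of [H^1], summed rather than Euclidean, so that its triangle
    inequality is Minkowski's applied to each term. *)
Definition sobolev_sum f : \bar R := (normL2 f + normL2 (wderiv f))%E.

Lemma sobolev_sum_lty chi f : partition_function chi -> H1 f ->
  (sobolev_sum f < +oo)%E.
Proof.
move=> pchi [_ /L2P[_ nf] [g fg /L2P[_ ng]]].
by rewrite /sobolev_sum (normL2_wderiv pchi fg) lte_add_pinfty.
Qed.

(** Since [wderiv] need not be linear, all three of its values are first replaced by [f'], [g'] and
    their combination. *)
Lemma sobolev_sumDZ chi c f g : partition_function chi -> H1 f -> H1 g ->
  (sobolev_sum (f \+ (fun x => c * g x))%R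
    <= sobolev_sum f + `|c|%:E * sobolev_sum g)%E.
Proof.
move=> pchi [cf hf [f' wf hf']] [cg hg [g' wg hg']].
rewrite /sobolev_sum (normL2_wderiv pchi wf) (normL2_wderiv pchi wg).
rewrite (normL2_wderiv pchi (weak_derivativeD wf (weak_derivativeZ c wg))).
rewrite ge0_muleDr ?normL2_ge0// addeACA.
have h (u v : R -> R) : L2 u -> L2 v ->
    (normL2 (u \+ (fun x => c * v x))%R <= normL2 u + `|c|%:E * normL2 v)%E.
  move=> hu hv; rewrite -normL2Z//; apply: normL2D; first by case/L2P : hu.
  by case/L2P : (L2Z c hv).
by apply: leeD; exact: h.
Qed.

(** For [a, b >= 0], [sqrt (a^2 + b^2) <= a + b <= 2 * sqrt (a^2 + b^2)]; the factor 2 is a coarse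
    substitute for [sqrt 2]. *)
Lemma normH1_sobolev_sum chi f : partition_function chi -> H1 f ->
  (normH1 f <= sobolev_sum f)%E /\ (sobolev_sum f <= 2%:E * normH1 f)%E.
Proof.
move=> pchi [_ /L2P[_ nf] [g fg /L2P[_ ng]]].
rewrite /normH1 /sobolev_sum (normL2_wderiv pchi fg).
move: (normL2_ge0 f) nf (normL2_ge0 g) ng.
case: (normL2 f) (normL2 g) => [a| |] // [b| |] //.
rewrite !lee_fin => a0 _ b0 _.
have s0 : 0 <= a ^+ 2 + b ^+ 2 by rewrite addr_ge0// sqr_ge0.
rewrite -!expr2 powR12_sqrt//.
have ab2 : 0 <= 2 * Num.sqrt (a ^+ 2 + b ^+ 2) by rewrite mulr_ge0// sqrtr_ge0.
split.
  rewrite -[leRHS](ger0_norm (addr_ge0 a0 b0)) -sqrtr_sqr ler_wsqrtr//.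
  by nra.
rewrite -(@ler_pXn2r _ 2) ?nnegrE ?addr_ge0//.
by rewrite exprMn sqr_sqrtr//; nra.
Qed.

Lemma normH1_ge0 f : (0 <= normH1 f)%E.
Proof. exact: poweR_ge0. Qed.

(** * Uniqueness of the decomposition of [U] and comparison of the norms *)

Lemma L2_eq_cst_ge1 f c : L2 f -> (forall x, 1 <= x -> f x = c) -> c = 0.
Proof.
move=> /Lfun2_integrable_sqr /integrableP[mf intf] fc.
apply/eqP; apply: contraPT intf => c0; apply/negP; rewrite -leNgt.
(* For [c] nonzero, the constant [c ^+ 2] already has infinite integral over the half-line. *)
apply: (@le_trans _ _ (\int[leb]_(x in `[1%R, +oo[) (c ^+ 2)%:E)%E).
  rewrite integral_cst//= lebesgue_measure_itv/= ltry.
  by rewrite /= gt0_muley// lte_fin exprn_even_gt0.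
apply: (@le_trans _ _ (\int[leb]_(x in `[1%R, +oo[)
    `|(EFin \o (fun x => f x ^+ 2)%R) x|)%E); last first.
  apply: ge0_subset_integral => //.
  exact: measurableT_comp.
rewrite le_eqVlt; apply/orP; left; apply/eqP; apply: eq_integral => x.
rewrite inE/= in_itv/= andbT => x1.
by rewrite fc// ger0_norm// sqr_ge0.
Qed.

Lemma Iinv_spec chi U : partition_function chi -> H0oo U ->
  H1 (Iinv chi U).1 /\ Imap chi (Iinv chi U) = U.
Proof.
move=> pchi [chi0 [pchi0 [[f c] [/= hf fU]]]].
apply: (@xgetPex _ _ [set p | H1 p.1 /\ Imap chi p = U]).
(* [U = f + c chi0] is rewritten with [chi] in place of [chi0]; a decomposition thus exists and
   [xget] does not fall back on its default. *)
exists (f \+ (fun x => c * (chi0 x - chi x)), c); split => /=.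
  by apply: H1D => //; apply: H1Z; exact: H1_partition_functionB.
by rewrite -fU; apply/funext => x; rewrite /Imap/=; ring.
Qed.

Lemma Iinv_change chi chi' U : partition_function chi ->
  partition_function chi' -> H0oo U ->
  (Iinv chi U).2 = (Iinv chi' U).2 /\
  (Iinv chi U).1 =
    (Iinv chi' U).1 \+ (fun x => (Iinv chi' U).2 * (chi' x - chi x)).
Proof.
move=> pchi pchi' hU.
have [hf eU] := Iinv_spec pchi hU; have [hf' eU'] := Iinv_spec pchi' hU.
move: (Iinv chi U) (Iinv chi' U) hf eU hf' eU' => [f c] [f' c'] /= hf eU hf' eU'.
have e x : f x + c * chi x = f' x + c' * chi' x.
  by have := congr1 (fun h => h x) eU; rewrite -eU'.
have cc' : c = c'.
  apply/eqP; rewrite eq_sym -subr_eq0; apply/eqP.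
  (* Both partition functions equal 1 on [[1, +oo[], where therefore [f - f' = c' - c]. *)
  apply: (@L2_eq_cst_ge1 (f \+ (fun x => -1 * f' x))).
    by apply: L2D; [case: hf|apply: L2Z; case: hf'].
  move=> x x1; have [_ _ o _] := pchi; have [_ _ o' _] := pchi'.
  by have := e x; rewrite o// o'//=; lra.
split => //; apply/funext => x /=.
by have := e x; rewrite cc'; lra.
Qed.

Lemma normE_change chi chi' : partition_function chi -> partition_function chi' ->
  exists2 C : R, 0 < C &
    forall X, (normE chi X <= C%:E * normE chi' X)%E.
Proof.
move=> pchi pchi'; set d := fun x => chi' x - chi x.
have hd : H1 d by exact: H1_partition_functionB.
have dfin := sobolev_sum_lty pchi hd.
have d0 : (0 <= sobolev_sum d)%E by rewrite adde_ge0 ?normL2_ge0.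
set K := fine (sobolev_sum d); have K0 : 0 <= K by exact: fine_ge0.
have dK : sobolev_sum d = K%:E by rewrite fineK// ge0_fin_numE.
(* The 2 comes from passing between [normH1] and [sobolev_sum], and [K] from the correction
   [c' * d]. The total coefficient of [|c'|] will be [K + 1], also below [2 + K]. *)
exists (2 + K); first by rewrite ltr_wpDr.
move=> [[zeta U] h]; rewrite /normE.
(* Membership in [Espace] does not involve the partition function, so outside it both norms are
   [+oo]. *)
case: asboolP => [|_]; last first.
  case: (Iinv chi U) (Iinv chi' U) => [? ?] [? ?].
  by rewrite gt0_muley// lte_fin ltr_wpDr.
move=> [/= _ hU _].
have [c2 f1] := Iinv_change pchi pchi' hU.
have [hf _] := Iinv_spec pchi hU; have [hf' _] := Iinv_spec pchi' hU.
move: c2 f1 hf hf'.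
case: (Iinv chi U) (Iinv chi' U) => [f c] [f' c'] /= -> -> hf hf'.
set F := (X in normH1 X).
have nF : (normH1 F <= 2%:E * normH1 f' + `|c'|%:E * K%:E)%E.
  apply: (le_trans (normH1_sobolev_sum pchi hf).1).
  apply: (le_trans (sobolev_sumDZ c' pchi hf' hd)).
  by rewrite dK leeD2r//; exact: (normH1_sobolev_sum pchi hf').2.
have V0 : (0 <= normV zeta)%E by rewrite adde_ge0// ?normL2_ge0// Lnorm_ge0.
have h0 := normL2_ge0 h; have f0 := normH1_ge0 f'.
have c0 : (0 <= `|c'|%:E)%E by rewrite lee_fin.
(* From here on only the nonnegativity of the components and the bound [nF] matter; the rest is
   arithmetic in the extended reals. *)
move: (normV zeta) (normL2 h) (normH1 f') (normH1 F) V0 h0 f0 nF.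
move=> v n u w v0 n0 u0 wle.
apply: (@le_trans _ _ (v + (2%:E * u + `|c'|%:E * K%:E) + `|c'|%:E + n)%E).
  by rewrite leeD2r// leeD2r// leeD2l.
have K2 : (0 <= (2 + K)%:E)%E by rewrite lee_fin addr_ge0.
rewrite !ge0_muleDr ?adde_ge0//.
have le1 (z : \bar R) : (0 <= z)%E -> (z <= (2 + K)%:E * z)%E.
  by move=> z0; rewrite -{1}[z]mul1e lee_wpmul2r// lee_fin; lra.
rewrite leeD ?le1// -!addeA leeD ?le1// leeD//.
  by rewrite lee_wpmul2r// lee_fin; lra.
rewrite -!EFinM -EFinD lee_fin.
by have := normr_ge0 c'; nra.
Qed.

End Sobolev.

Theorem theorem6p1 (R : realType) (chi chi' : R -> R)
    (hchi : partition_function chi) (hchi' : partition_function chi') :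
  exists2 C : R, 0 < C &
    forall p q : (R -> R) * {finite_measure set (measurableTypeR R) -> \bar R},
      Dspace p -> Dspace q ->
      ((C^-1)%:E * distD chi' p q <= distD chi p q)%E /\
      (distD chi p q <= C%:E * distD chi' p q)%E.
Proof.
(* The norm comparison applies to every triple, in particular to [Lmap p - Lmap q]. Exchanging the
   roles of [chi] and [chi'] gives the other inequality; norms being nonnegative, the larger
   constant serves both. *)
have [C C0 hC] := normE_change hchi hchi'.
have [C' C'0 hC'] := normE_change hchi' hchi.
exists (Num.max C C'); first by rewrite lt_max C0.
have n0 (x : R -> R) X : (0 <= normE x X)%E.
  case: X => [[zeta U] h]; rewrite /normE; case: Iinv => f c; case: ifP => // _.
  by rewrite !adde_ge0 ?normL2_ge0 ?normH1_ge0 ?Lnorm_ge0// lee_fin.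
move=> p q _ _; split.
  rewrite lee_pdivrMl ?lt_max ?C0//.
  apply: (le_trans (hC' _)); rewrite lee_wpmul2r ?n0//.
  by rewrite lee_fin le_max lexx orbT.
apply: (le_trans (hC _)); rewrite lee_wpmul2r ?n0//.
by rewrite lee_fin le_max lexx.
Qed.
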